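(* Let $\phi = \frac{1+\sqrt5}{2}$, $a(k) = \lfloor k\phi\rfloor$ and $d(k) = 3a(k)+k$. Then for every positive integer $k$, \[ \{d(k)\phi\} = 1 - \frac{\sqrt5}{\phi^2}\{k\phi\}. \]
   Context: $\{x\} = x - \lfloor x\rfloor$ denotes the fractional part. *)

(* Defs.v *)
From Stdlib Require Import Reals.
Open Scope R_scope.

Definition phi : R := (1 + sqrt 5) / 2.

(* [Int_part] is the floor function, and [frac_part x] is
   [x - IZR (Int_part x)], for negative arguments as well. *)
Definition a (k : Z) : Z := Int_part (IZR k * phi).

Definition d (k : Z) : Z := (3 * a k + k)%Z.

(* Main.v *)
Require Import Defs.
From Stdlib Require Import Reals.
From Stdlib Require Import Lra Lia ZArith.
Open Scope R_scope.

(** With [x = {k phi}] and [phi^2 = phi + 1] one gets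
    [d(k) phi = 4 a(k) + 3 k - (3 phi - 4) x], where
    [3 phi - 4 = sqrt 5 / phi^2] lies strictly between 0 and 1. As [phi] is
    irrational, [x > 0], so the fractional part is [1 - (3 phi - 4) x]. *)

Lemma phi_sqr : phi * phi = phi + 1.
Proof.
  unfold phi. pose proof (sqrt_sqrt 5 ltac:(lra)). nra.
Qed.

(** These bounds are exactly what places [3 * phi - 4] strictly between 0 and 1. *)
Lemma phi_bounds : 4 / 3 < phi < 5 / 3.
Proof.
  pose proof phi_sqr. assert (0 < phi).
  { unfold phi. pose proof (sqrt_pos 5). lra. }
  split; nra.
Qed.

(* Infinite descent: a solution [(n, k)] yields the smaller one [(k, n - k)]. *)
Lemma no_golden_ratio_in_Z (k n : Z) :
  (0 < k)%Z -> (0 < n)%Z -> (n * n <> n * k + k * k)%Z.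
Proof.
  intros hk. assert (h0 : (0 <= k)%Z) by lia. revert n hk.
  pattern k; apply Zlt_0_ind; [|exact h0].
  clear k h0; intros k IH _ n hk hn e.
  (* The two bounds give [0 < n - k < k], so the descent stays positive and decreases. *)
  assert (k < n)%Z by nia.
  assert (n < 2 * k)%Z by nia.
  apply (IH (n - k)%Z ltac:(lia) k); nia.
Qed.

(** Multiplying [phi * phi = phi + 1] by the square of [k] would give [n * n = n * k + k * k] in
    integers. *)
Lemma IZR_mul_phi_neq (k n : Z) : (0 < k)%Z -> IZR k * phi <> IZR n.
Proof.
  intros hk e. pose proof phi_bounds. pose proof phi_sqr as h.
  assert (hk' : 0 < IZR k) by now apply IZR_lt.
  apply (no_golden_ratio_in_Z k n hk).
  - apply lt_IZR. rewrite <- e. nra.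
  - apply eq_IZR. rewrite plus_IZR, !mult_IZR, <- e.
    replace (IZR k * phi * (IZR k * phi)) with (IZR k * IZR k * (phi * phi)) by ring.
    rewrite h. ring.
Qed.

Lemma frac_part_unique (r y : R) (z : Z) :
  r = IZR z + y -> 0 <= y < 1 -> frac_part r = y.
Proof.
  intros e hy. unfold frac_part.
  rewrite <- (Int_part_spec r z) by lra. lra.
Qed.

Lemma sqrt5_div_phi_sqr : sqrt 5 / phi ^ 2 = 3 * phi - 4.
Proof.
  pose proof phi_bounds. pose proof phi_sqr as h.
  assert (hs : sqrt 5 = 2 * phi - 1) by (unfold phi; lra).
  apply Rmult_eq_reg_r with (phi ^ 2); [|nra].
  unfold Rdiv. rewrite Rmult_assoc, Rinv_l, hs by nra.
  replace (phi ^ 2) with (phi + 1) by (rewrite <- h; ring).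
  (* By [phi_sqr], [(3 * phi - 4) * (phi + 1)] reduces to [2 * phi - 1]. *)
  nra.
Qed.

Theorem theorem4p3 (k : Z) (hk : (0 < k)%Z) :
  frac_part (IZR (d k) * phi)
  = 1 - sqrt 5 / phi ^ 2 * frac_part (IZR k * phi).
Proof.
  rewrite sqrt5_div_phi_sqr.
  pose proof phi_bounds. pose proof phi_sqr as h.
  destruct (base_fp (IZR k * phi)) as [h0 h1].
  assert (hx : frac_part (IZR k * phi) = IZR k * phi - IZR (a k)) by reflexivity.
  pose proof (IZR_mul_phi_neq k (a k) hk).
  set (x := frac_part (IZR k * phi)) in *.
  assert (0 < x) by lra.
  (* The [- 1] is a borrow: [- (3 * phi - 4) * x] lies in (-1, 0), and adding 1 brings it into [0,
     1). *)
  apply frac_part_unique with (4 * a k + 3 * k - 1)%Z; [|split; nra].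
  unfold d. rewrite minus_IZR, !plus_IZR, !mult_IZR.
  replace (IZR (a k)) with (IZR k * phi - x) by lra.
  replace ((3 * (IZR k * phi - x) + IZR k) * phi)
    with (3 * IZR k * (phi * phi) - 3 * x * phi + IZR k * phi) by ring.
  rewrite h. ring.
Qed.
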